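(* Let $\{B_k,\ 0\le k\le 2n+1\}$ be the generalized quadratic B-splines of $GS_2(I,X,\beta)$ and $\{\bar B_l,\ 0\le l\le 4n+1\}$ those of the refined space $GS_2(I,\bar X,\bar\beta)$. (i) For all $1\le i\le n-1$, $$B_{2i}=\big(\tfrac12+\tfrac14\beta_i\big)\bar B_{4i-2}+\big(\tfrac12-\tfrac14\beta_i\big)\bar B_{4i-1}+\tfrac12(1+\omega_i)\bar B_{4i}+\tfrac12\omega_i\bar B_{4i+1},$$ $$B_{2i+1}=\tfrac12(1-\omega_i)\bar B_{4i}+\tfrac12(2-\omega_i)\bar B_{4i+1}+\big(\tfrac12-\tfrac14\beta_{i+1}\big)\bar B_{4i+2}+\big(\tfrac12+\tfrac14\beta_{i+1}\big)\bar B_{4i+3}.$$ (ii) For the B-splines at the endpoints, $$B_0=\bar B_0+\tfrac12\bar B_1,\qquad B_1=\tfrac12\bar B_1+\big(\tfrac12-\tfrac14\beta_1\big)\bar B_2+\big(\tfrac12+\tfrac14\beta_1\big)\bar B_3,$$ $$B_{2n}=\tfrac12\bar B_{4n}+\big(\tfrac12-\tfrac14\beta_n\big)\bar B_{4n-1}+\big(\tfrac12+\tfrac14\beta_n\big)\bar B_{4n-2},\qquad B_{2n+1}=\tfrac12\bar B_{4n}+\bar B_{4n+1}.$$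
   Context: Setting. Let $n\ge 1$, $I=[a,b]$, $X=\{a=x_0<x_1<\dots<x_n=b\}$ a partition of $I$, $I_i=[x_{i-1},x_i]$, $h_i=x_i-x_{i-1}$, $m_i=\frac12(x_{i-1}+x_i)$ for $1\le i\le n$. Let $\beta=(\beta_1,\dots,\beta_n)$ with $\beta_i\in[-1,0[$ and $\theta_i=\frac12\frac{\beta_i}{\beta_i-1}\in\,]0,\frac14]$ (equivalently $\beta_i=\frac{-2\theta_i}{1-2\theta_i}$). The space $V(\beta_i)$ (generated by the Merrien subdivision algorithm) is the set of $C^1$ functions $f$ on $I_i$ such that for every dyadic subinterval $[u,v]$ of $I_i$ (i.e. every interval obtained from $I_i$ by repeated bisection, including $I_i$ itself), with $m=\frac12(u+v)$ and $h=v-u$, $$f(m)=\tfrac12\big(f(u)+f(v)-\theta_i h\,(f'(v)-f'(u))\big),\qquad f'(m)=\frac{1}{1-2\theta_i}\Big(\frac{f(v)-f(u)}{h}-2\theta_i\,\frac{f'(u)+f'(v)}{2}\Big).$$ It is known that for any prescribed values of $f,f'$ at the two endpoints of $I_i$ there is exactly one such $f$; so $\dim V(\beta_i)=4$. $GS_2(\beta)=GS_2(I,X,\beta)$ is the space of all $g\in C^1(I)$ with $g|_{I_i}\in V(\beta_i)$ for all $1\le i\le n$ (generalized quadratic splines); it has dimension $2n+2$. The list of B-coefficients of $f\in V(\beta_i)$ on $I_i$ is $[\,f(x_{i-1}),\ f(x_{i-1})+\theta_ih_if'(x_{i-1}),\ f(x_i)-\theta_ih_if'(x_i),\ f(x_i)\,]$;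 it determines $f$ uniquely. For $1\le i\le n-1$ let $\omega_i=\frac{\theta_{i+1}h_{i+1}}{\theta_ih_i+\theta_{i+1}h_{i+1}}$. The generalized quadratic B-splines are the functions on $I$ defined by their B-coefficients as follows (all B-coefficients on subintervals not mentioned are zero). For $1\le i\le n-1$: $B_{2i}$ has lists $[0,0,1,\omega_i]$ on $I_i$ and $[\omega_i,0,0,0]$ on $I_{i+1}$; $B_{2i+1}$ has lists $[0,0,0,1-\omega_i]$ on $I_i$ and $[1-\omega_i,1,0,0]$ on $I_{i+1}$. At the ends: $B_0$ has list $[1,0,0,0]$ on $I_1$; $B_1$ has list $[0,1,0,0]$ on $I_1$; $B_{2n}$ has list $[0,0,1,0]$ on $I_n$; $B_{2n+1}$ has list $[0,0,0,1]$ on $I_n$. The family $\{B_k\}_{0\le k\le 2n+1}$ is a basis of $GS_2(\beta)$. Refinement. Let $\bar X=X\cup\{m_i,\ 1\le i\le n\}$, which divides $I$ into $2n$ subintervals, and $\bar\beta=(\beta_1,\beta_1,\beta_2,\beta_2,\dots,\beta_n,\beta_n)$. Then $GS_2(I,X,\beta)$ is a subspace of $GS_2(I,\bar X,\bar\beta)$, which has dimension $4n+2$. The functions $\bar B_l$, $0\le l\le 4n+1$, are the generalized quadratic B-splines of $GS_2(I,\bar X,\bar\beta)$, i.e. the following functions. Write $J_{2i-1}=[x_{i-1},m_i]$ and $J_{2i}=[m_i,x_i]$ for $1\le i\le n$; on both of these subintervals the parameter is $\theta_i$ and the length is $\frac12h_i$, so that the list of B-coefficients of $f$ on $J_j=[u,v]$,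 for $j\in\{2i-1,2i\}$, is $[\,f(u),\ f(u)+\frac12\theta_ih_if'(u),\ f(v)-\frac12\theta_ih_if'(v),\ f(v)\,]$. Let $\bar\omega_{2i-1}=\frac12$ for $1\le i\le n$ and $\bar\omega_{2i}=\omega_i$ for $1\le i\le n-1$. The $\bar B_l$ are defined by their B-coefficients on the $J_j$ (all B-coefficients on subintervals $J_j$ not mentioned are zero). For $1\le j\le 2n-1$: $\bar B_{2j}$ has lists $[0,0,1,\bar\omega_j]$ on $J_j$ and $[\bar\omega_j,0,0,0]$ on $J_{j+1}$; $\bar B_{2j+1}$ has lists $[0,0,0,1-\bar\omega_j]$ on $J_j$ and $[1-\bar\omega_j,1,0,0]$ on $J_{j+1}$. At the ends: $\bar B_0$ has list $[1,0,0,0]$ on $J_1$; $\bar B_1$ has list $[0,1,0,0]$ on $J_1$; $\bar B_{4n}$ has list $[0,0,1,0]$ on $J_{2n}$; $\bar B_{4n+1}$ has list $[0,0,0,1]$ on $J_{2n}$. *)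

(* Defs.v *)
From Stdlib Require Export Reals Lra Lia Arith List.
Export ListNotations.
Open Scope R_scope.

Definition theta (beta : R) : R := / 2 * (beta / (beta - 1)).

Definition Icc (u v : R) : R -> Prop := fun t => u <= t <= v.

(* [f] is C^1 on the closed interval [u,v] with derivative [df]; since the
   derivative is taken within [u,v], it is one-sided at the endpoints. Values of
   [f] and [df] outside [u,v] are irrelevant, and [df] is determined by [f] on
   [u,v] as soon as u < v. *)
Definition C1_with_deriv (u v : R) (f df : R -> R) : Prop :=
  forall t, Icc u v t -> D_in f df (Icc u v) t /\ continue_in df (Icc u v) t.

Inductive dyadic_sub (a b : R) : R -> R -> Prop :=
| dyadic_whole : dyadic_sub a b a b
| dyadic_left (u v : R) : dyadic_sub a b u v -> dyadic_sub a b u ((u + v) / 2)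
| dyadic_right (u v : R) : dyadic_sub a b u v -> dyadic_sub a b ((u + v) / 2) v.

Definition merrien_rule (th : R) (f df : R -> R) (u v : R) : Prop :=
  let m := (u + v) / 2 in
  let h := v - u in
  f m = / 2 * (f u + f v - th * h * (df v - df u)) /\
  df m = / (1 - 2 * th) *
         ((f v - f u) / h - 2 * th * ((df u + df v) / 2)).

Definition in_V (beta u v : R) (f : R -> R) : Prop :=
  exists df, C1_with_deriv u v f df /\
    forall s t, dyadic_sub u v s t -> merrien_rule (theta beta) f df s t.

(* The subintervals and their parameters are numbered from 1: the i-th one is
   [x (i-1), x i] and carries [beta i], for 1 <= i <= n. *)
Definition is_partition (n : nat) (a b : R) (x : nat -> R) : Prop :=
  x 0%nat = a /\ x n = b /\ forall i, (1 <= i <= n)%nat -> x (i - 1)%nat < x i.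

Definition in_GS2 (n : nat) (x beta : nat -> R) (g : R -> R) : Prop :=
  (exists dg, C1_with_deriv (x 0%nat) (x n) g dg) /\
  forall i, (1 <= i <= n)%nat -> in_V (beta i) (x (i - 1)%nat) (x i) g.

Definition has_Bcoeffs (beta u v : R) (f : R -> R) (l : list R) : Prop :=
  exists df, C1_with_deriv u v f df /\
    l = [ f u;
          f u + theta beta * (v - u) * df u;
          f v - theta beta * (v - u) * df v;
          f v ].

Definition is_spline_with_Bcoeffs (n : nat) (x beta : nat -> R)
    (L : nat -> list R) (g : R -> R) : Prop :=
  in_GS2 n x beta g /\
  forall i, (1 <= i <= n)%nat ->
    has_Bcoeffs (beta i) (x (i - 1)%nat) (x i) g (L i).

Definition omega (x beta : nat -> R) (i : nat) : R :=
  let d j := theta (beta j) * (x j - x (j - 1)%nat) in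
  d (i + 1)%nat / (d i + d (i + 1)%nat).

Definition zero_list : list R := [0; 0; 0; 0].

Definition list_on (i : nat) (l : list R) : nat -> list R :=
  fun r => if Nat.eqb r i then l else zero_list.

Definition lists_on_succ (i : nat) (l l' : list R) : nat -> list R :=
  fun r => if Nat.eqb r i then l
           else if Nat.eqb r (i + 1) then l' else zero_list.

Record is_Bsplines (n : nat) (x beta : nat -> R) (B : nat -> R -> R) : Prop := {
  Bspline_even : forall i, (1 <= i <= n - 1)%nat ->
    is_spline_with_Bcoeffs n x beta
      (lists_on_succ i [0; 0; 1; omega x beta i] [omega x beta i; 0; 0; 0])
      (B (2 * i)%nat);
  Bspline_odd : forall i, (1 <= i <= n - 1)%nat ->
    is_spline_with_Bcoeffs n x beta
      (lists_on_succ i [0; 0; 0; 1 - omega x beta i]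
                       [1 - omega x beta i; 1; 0; 0])
      (B (2 * i + 1)%nat);
  Bspline_first0 :
    is_spline_with_Bcoeffs n x beta (list_on 1 [1; 0; 0; 0]) (B 0%nat);
  Bspline_first1 :
    is_spline_with_Bcoeffs n x beta (list_on 1 [0; 1; 0; 0]) (B 1%nat);
  Bspline_last0 :
    is_spline_with_Bcoeffs n x beta (list_on n [0; 0; 1; 0]) (B (2 * n)%nat);
  Bspline_last1 :
    is_spline_with_Bcoeffs n x beta (list_on n [0; 0; 0; 1]) (B (2 * n + 1)%nat)
}.

(* Knots x_0, m_1, x_1, m_2, ..., m_n, x_n. *)
Definition refined_knots (x : nat -> R) (j : nat) : R :=
  if Nat.even j then x (Nat.div2 j)
  else (x (Nat.div2 j) + x (Nat.div2 j + 1)%nat) / 2.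

(* Numbered from 1: beta_1, beta_1, beta_2, beta_2, ..., beta_n, beta_n. *)
Definition refined_params (beta : nat -> R) (j : nat) : R :=
  beta (Nat.div2 (j + 1)).

(* Main.v *)
Require Import Defs.
From Stdlib Require Import Reals Lra Lia Arith List.
Open Scope R_scope.

(** The B-coefficients of [f] on an interval encode the values and slopes of
    [f] at both ends, and the Merrien rule propagates values and slopes from the
    ends of a dyadic interval to its midpoint.  Two consequences carry the
    proof.

    Subdivision: expressed in B-coefficients, one Merrien step is affine and
    involves neither the interval nor its length.  A spline with lists
    [[c0; c1; c2; c3]] on the coarse knots is therefore a spline on the refined
    knots, and its lists there come from the de Casteljau-like formulas
    [left_half] and [right_half] ([spline_subdivide]).

    Uniqueness: an element of V(beta) whose B-coefficients all vanish has zero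
    value and slope at the ends, hence at all dyadic points, hence vanishes by
    density and continuity ([in_V_zero]).  By linearity, splines with the same
    lists coincide ([spline_unique]).

    Each refinement identity is thus an identity between finite lists: the
    subdivided lists of the coarse B-spline against the same combination of the
    lists of the fine ones.  The only geometric input left is the value of the
    refined weights: [1/2] at an inserted midpoint, since its two neighbours
    have equal length and equal parameter, and [omega x beta i] at an old knot,
    since halving both neighbours leaves the ratio unchanged. *)

(** * C^1 functions on an interval *)

Lemma D_in_subset (f df : R -> R) (D D' : R -> Prop) (t : R) :
  (forall s, D' s -> D s) -> D_in f df D t -> D_in f df D' t.
Proof.
  intros HD H e He.
  destruct (H e He) as [d [Hd Hlim]].
  exists d; split; [exact Hd|].
  intros s [[Hs Hne] Hdist].
  apply Hlim; split; [split; auto|exact Hdist].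
Qed.

Lemma continue_in_subset (f : R -> R) (D D' : R -> Prop) (t : R) :
  (forall s, D' s -> D s) -> continue_in f D t -> continue_in f D' t.
Proof.
  intros HD H e He.
  destruct (H e He) as [d [Hd Hlim]].
  exists d; split; [exact Hd|].
  intros s [[Hs Hne] Hdist].
  apply Hlim; split; [split; auto|exact Hdist].
Qed.

Lemma C1_with_deriv_subset (u v u' v' : R) (f df : R -> R) :
  u <= u' -> v' <= v -> C1_with_deriv u v f df -> C1_with_deriv u' v' f df.
Proof.
  intros Hu Hv H t Ht.
  assert (Hsub : forall s, Icc u' v' s -> Icc u v s)
    by (unfold Icc; intros s Hs; lra).
  destruct (H t (Hsub t Ht)) as [HD HC]; split.
  - now apply D_in_subset with (Icc u v).
  - now apply continue_in_subset with (Icc u v).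
Qed.

Lemma C1_with_deriv_add (u v : R) (f df g dg : R -> R) :
  C1_with_deriv u v f df -> C1_with_deriv u v g dg ->
  C1_with_deriv u v (fun t => f t + g t) (fun t => df t + dg t).
Proof.
  intros Hf Hg t Ht.
  destruct (Hf t Ht) as [Df Cf]; destruct (Hg t Ht) as [Dg Cg]; split.
  - now apply Dadd.
  - now apply limit_plus.
Qed.

Lemma C1_with_deriv_scale (c u v : R) (f df : R -> R) :
  C1_with_deriv u v f df ->
  C1_with_deriv u v (fun t => c * f t) (fun t => c * df t).
Proof.
  intros Hf t Ht.
  destruct (Hf t Ht) as [Df Cf]; split.
  - now apply Dmult_const.
  - apply (limit_mul (fun _ => c) df); [|exact Cf].
    exact (limit_free (fun _ => c) _ t t).
Qed.

Lemma Icc_adherent (u v t : R) :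
  u < v -> Icc u v t -> adhDa (D_x (Icc u v) t) t.
Proof.
  intros Huv Ht e He.
  unfold D_x, Icc, Rdist in *.
  destruct (Rlt_dec t v) as [Htv|Htv].
  - set (d := Rmin (e / 2) (v - t)).
    assert (0 < d) by (apply Rmin_glb_lt; lra).
    assert (d <= e / 2) by apply Rmin_l.
    assert (d <= v - t) by apply Rmin_r.
    exists (t + d); split; [split; lra|].
    replace (t + d - t) with d by ring.
    rewrite Rabs_pos_eq; lra.
  - set (d := Rmin (e / 2) (t - u)).
    assert (0 < d) by (apply Rmin_glb_lt; lra).
    assert (d <= e / 2) by apply Rmin_l.
    assert (d <= t - u) by apply Rmin_r.
    exists (t - d); split; [split; lra|].
    replace (t - d - t) with (- d) by ring.
    rewrite Rabs_Ropp, Rabs_pos_eq; lra.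
Qed.

Lemma C1_with_deriv_unique (u v : R) (f df dg : R -> R) (t : R) :
  u < v -> Icc u v t ->
  C1_with_deriv u v f df -> C1_with_deriv u v f dg -> df t = dg t.
Proof.
  intros Huv Ht Hf Hg.
  destruct (Hf t Ht) as [Df _]; destruct (Hg t Ht) as [Dg _].
  exact (single_limit _ _ _ _ _ (Icc_adherent u v t Huv Ht) Df Dg).
Qed.

(** * Dyadic subintervals *)

Lemma dyadic_sub_trans (a b u v s t : R) :
  dyadic_sub a b u v -> dyadic_sub u v s t -> dyadic_sub a b s t.
Proof.
  intros Huv Hst.
  induction Hst; [exact Huv|now constructor|now constructor].
Qed.

Lemma dyadic_sub_bounds (a b s t : R) :
  a < b -> dyadic_sub a b s t -> a <= s /\ s < t /\ t <= b.
Proof. intros Hab H; induction H; lra. Qed.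

Lemma dyadic_sub_around (a b t : R) (k : nat) :
  Icc a b t ->
  exists u v, dyadic_sub a b u v /\ Icc u v t /\ v - u = (b - a) * (/ 2) ^ k.
Proof.
  intros Ht; induction k as [|k (u & v & Huv & Hin & Hlen)].
  - exists a, b; repeat split; [constructor|apply Ht|apply Ht|simpl; lra].
  - unfold Icc in *; simpl pow.
    destruct (Rle_dec t ((u + v) / 2)).
    + exists u, ((u + v) / 2); repeat split; [now constructor|lra|lra|lra].
    + exists ((u + v) / 2), v; repeat split; [now constructor|lra|lra|lra].
Qed.

Ltac list_entries :=
  repeat match goal with
  | |- (_ :: _) = (_ :: _) => apply (f_equal2 cons)
  | |- [] = [] => reflexivity
  end.

(** * Elements of V(beta) and their B-coefficients *)

Lemma theta_pos (beta : R) : beta < 0 -> 0 < theta beta.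
Proof.
  intros H; unfold theta.
  replace (/ 2 * (beta / (beta - 1))) with (- beta / (2 * (1 - beta)))
    by (field; lra).
  apply Rdiv_lt_0_compat; lra.
Qed.

Definition list_add (l l' : list R) : list R :=
  map (fun p => fst p + snd p) (combine l l').

Definition list_scale (c : R) (l : list R) : list R := map (Rmult c) l.

(** [in_V] and [has_Bcoeffs] each assert the existence of a derivative;
    uniqueness of one-sided derivatives lets a single one serve both. *)
Lemma in_V_Bcoeffs (beta u v : R) (f : R -> R) (l : list R) :
  u < v -> in_V beta u v f -> has_Bcoeffs beta u v f l ->
  exists df, C1_with_deriv u v f df /\
    (forall s t, dyadic_sub u v s t -> merrien_rule (theta beta) f df s t) /\
    l = [ f u;
          f u + theta beta * (v - u) * df u;
          f v - theta beta * (v - u) * df v;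
          f v ].
Proof.
  intros Huv (df & HC & HM) (dg & HC' & ->).
  exists df; repeat split; try apply HC; try apply HM; auto.
  rewrite (C1_with_deriv_unique u v f df dg u), (C1_with_deriv_unique u v f df dg v);
    unfold Icc; auto; lra.
Qed.

Lemma in_V_add (beta u v : R) (f g : R -> R) :
  in_V beta u v f -> in_V beta u v g -> in_V beta u v (fun t => f t + g t).
Proof.
  intros (df & HC & HM) (dg & HC' & HM').
  exists (fun t => df t + dg t); split; [now apply C1_with_deriv_add|].
  intros s t Hst.
  destruct (HM s t Hst) as [H1 H2]; destruct (HM' s t Hst) as [H1' H2'].
  split; cbv beta zeta; [rewrite H1, H1'|rewrite H2, H2']; unfold Rdiv; ring.
Qed.

Lemma in_V_scale (c beta u v : R) (f : R -> R) :
  in_V beta u v f -> in_V beta u v (fun t => c * f t).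
Proof.
  intros (df & HC & HM).
  exists (fun t => c * df t); split; [now apply C1_with_deriv_scale|].
  intros s t Hst.
  destruct (HM s t Hst) as [H1 H2].
  split; cbv beta zeta; [rewrite H1|rewrite H2]; unfold Rdiv; ring.
Qed.

Lemma has_Bcoeffs_add (beta u v : R) (f g : R -> R) (l l' : list R) :
  has_Bcoeffs beta u v f l -> has_Bcoeffs beta u v g l' ->
  has_Bcoeffs beta u v (fun t => f t + g t) (list_add l l').
Proof.
  intros (df & HC & ->) (dg & HC' & ->).
  exists (fun t => df t + dg t); split; [now apply C1_with_deriv_add|].
  unfold list_add; simpl; list_entries; ring.
Qed.

Lemma has_Bcoeffs_scale (c beta u v : R) (f : R -> R) (l : list R) :
  has_Bcoeffs beta u v f l ->
  has_Bcoeffs beta u v (fun t => c * f t) (list_scale c l).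
Proof.
  intros (df & HC & ->).
  exists (fun t => c * df t); split; [now apply C1_with_deriv_scale|].
  unfold list_scale; simpl; list_entries; ring.
Qed.

(** The Merrien rule sends zero data at the ends to zero data at the midpoint,
    so [f] vanishes at both ends of every dyadic subinterval.  These ends are
    dense, and [f] is continuous. *)
Lemma in_V_zero (beta u v : R) (f : R -> R) :
  -1 <= beta < 0 -> u < v -> in_V beta u v f ->
  has_Bcoeffs beta u v f zero_list -> forall t, Icc u v t -> f t = 0.
Proof.
  intros Hb Huv HV HB.
  destruct (in_V_Bcoeffs _ _ _ _ _ Huv HV HB) as (df & HC & HM & Hl).
  unfold zero_list in Hl; injection Hl as H0 H1 H2 H3.
  pose proof (theta_pos beta (proj2 Hb)) as Hth.
  assert (Hnz : theta beta * (v - u) <> 0)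
    by (apply Rmult_integral_contrapositive; split; lra).
  assert (Hdu : df u = 0) by (apply Rmult_eq_reg_l with (2 := Hnz); lra).
  assert (Hdv : df v = 0) by (apply Rmult_eq_reg_l with (2 := Hnz); lra).
  assert (Hz : forall s t, dyadic_sub u v s t ->
    f s = 0 /\ df s = 0 /\ f t = 0 /\ df t = 0).
  { intros s t Hst; induction Hst as [|s t Hst IH|s t Hst IH];
      [auto| |]; destruct IH as (E1 & E2 & E3 & E4);
      destruct (HM s t Hst) as [M1 M2];
      rewrite E1, E2, E3, E4 in *;
      repeat split; auto; rewrite ?M1, ?M2; unfold Rdiv; ring. }
  intros t Ht.
  destruct (Req_dec (f t) 0) as [E|E]; [exact E|exfalso].
  assert (Hc : continue_in f (Icc u v) t)
    by exact (cont_deriv _ _ _ _ (proj1 (HC t Ht))).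
  destruct (Hc (Rabs (f t)) (Rabs_pos_lt _ E)) as (d & Hd & Hlim).
  destruct (pow_lt_1_zero (/ 2)) with (y := d / (v - u)) as [k Hk].
  { rewrite Rabs_pos_eq; lra. }
  { apply Rdiv_lt_0_compat; lra. }
  destruct (dyadic_sub_around u v t k Ht) as (p & q & Hpq & Hin & Hlen).
  assert (Hsmall : q - p < d).
  { specialize (Hk k (le_n k)).
    rewrite Rabs_pos_eq in Hk by (apply pow_le; lra).
    rewrite Hlen.
    replace d with ((v - u) * (d / (v - u))) by (field; lra).
    apply Rmult_lt_compat_l; lra. }
  destruct (dyadic_sub_bounds _ _ _ _ Huv Hpq) as (B1 & B2 & B3).
  destruct (Hz p q Hpq) as (Hp & _).
  assert (Hne : t <> p) by (intros ->; contradiction).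
  assert (Hlt : Rabs (f p - f t) < Rabs (f t)).
  { apply (Hlim p); unfold D_x, Icc in *; split; [repeat split; auto; lra|].
    simpl; unfold Rdist.
    rewrite Rabs_minus_sym, Rabs_pos_eq; lra. }
  rewrite Hp, Rminus_0_l, Rabs_Ropp in Hlt; lra.
Qed.

(** B-coefficients on the left half: the second one is a midpoint because the
    step [theta * h] halves with [h]; the last two are the value at the midpoint
    of the interval and the tangent point before it, where
    [theta / (1 - 2 * theta) = - beta / 2] has been used. *)
Definition left_half (beta : R) (l : list R) : list R :=
  match l with
  | [c0; c1; c2; c3] =>
      [ c0; (c0 + c1) / 2;
        (1 / 2 - 1 / 4 * beta) * c1 + (1 / 2 + 1 / 4 * beta) * c2;
        (c1 + c2) / 2 ]
  | _ => l
  end.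

Definition right_half (beta : R) (l : list R) : list R :=
  match l with
  | [c0; c1; c2; c3] =>
      [ (c1 + c2) / 2;
        (1 / 2 + 1 / 4 * beta) * c1 + (1 / 2 - 1 / 4 * beta) * c2;
        (c2 + c3) / 2; c3 ]
  | _ => l
  end.

Lemma in_V_dyadic (beta u v s t : R) (f : R -> R) :
  u < v -> dyadic_sub u v s t -> in_V beta u v f -> in_V beta s t f.
Proof.
  intros Huv Hst (df & HC & HM).
  destruct (dyadic_sub_bounds _ _ _ _ Huv Hst) as (H1 & H2 & H3).
  exists df; split; [now apply C1_with_deriv_subset with u v|].
  intros p q Hpq; apply HM; now apply dyadic_sub_trans with s t.
Qed.

Lemma has_Bcoeffs_halves (beta u v : R) (f : R -> R) (l : list R) :
  -1 <= beta < 0 -> u < v -> in_V beta u v f -> has_Bcoeffs beta u v f l ->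
  has_Bcoeffs beta u ((u + v) / 2) f (left_half beta l) /\
  has_Bcoeffs beta ((u + v) / 2) v f (right_half beta l).
Proof.
  intros Hb Huv HV HB.
  destruct (in_V_Bcoeffs _ _ _ _ _ Huv HV HB) as (df & HC & HM & ->).
  destruct (HM u v (dyadic_whole u v)) as [M1 M2].
  (* The slope at the midpoint, in the unit in which B-coefficients see it. *)
  assert (Hslope : theta beta * (v - u) * df ((u + v) / 2) =
    - beta / 2 * (f v - f u - theta beta * (v - u) * (df u + df v))).
  { rewrite M2; unfold theta.
    field; repeat split; lra. }
  split; exists df; split;
    try (apply C1_with_deriv_subset with u v; auto; lra);
    unfold left_half, right_half; list_entries; try field.
  - transitivity (f ((u + v) / 2)
      - / 2 * (theta beta * (v - u) * df ((u + v) / 2))); [|field].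
    rewrite Hslope, M1; field.
  - rewrite M1; field.
  - rewrite M1; field.
  - transitivity (f ((u + v) / 2)
      + / 2 * (theta beta * (v - u) * df ((u + v) / 2))); [|field].
    rewrite Hslope, M1; field.
Qed.

(** * Splines prescribed by their B-coefficients *)

Definition increasing_knots (n : nat) (x : nat -> R) : Prop :=
  forall i, (1 <= i <= n)%nat -> x (i - 1)%nat < x i.

Definition admissible_params (n : nat) (beta : nat -> R) : Prop :=
  forall i, (1 <= i <= n)%nat -> -1 <= beta i < 0.

Lemma spline_add (n : nat) (x beta : nat -> R) (L L' : nat -> list R)
    (f g : R -> R) :
  is_spline_with_Bcoeffs n x beta L f -> is_spline_with_Bcoeffs n x beta L' g ->
  is_spline_with_Bcoeffs n x beta
    (fun i => list_add (L i) (L' i)) (fun t => f t + g t).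
Proof.
  intros [[[df Df] Vf] Bf] [[[dg Dg] Vg] Bg]; split; [split|].
  - exists (fun t => df t + dg t); now apply C1_with_deriv_add.
  - intros i Hi; apply in_V_add; auto.
  - intros i Hi; apply has_Bcoeffs_add; auto.
Qed.

Lemma spline_scale (c : R) (n : nat) (x beta : nat -> R) (L : nat -> list R)
    (f : R -> R) :
  is_spline_with_Bcoeffs n x beta L f ->
  is_spline_with_Bcoeffs n x beta
    (fun i => list_scale c (L i)) (fun t => c * f t).
Proof.
  intros [[[df Df] Vf] Bf]; split; [split|].
  - exists (fun t => c * df t); now apply C1_with_deriv_scale.
  - intros i Hi; apply in_V_scale; auto.
  - intros i Hi; apply has_Bcoeffs_scale; auto.
Qed.

Lemma knot_interval (x : nat -> R) (n : nat) (t : R) :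
  (1 <= n)%nat -> Icc (x 0%nat) (x n) t ->
  exists i, (1 <= i <= n)%nat /\ Icc (x (i - 1)%nat) (x i) t.
Proof.
  induction n as [|n IH]; [lia|intros _ Ht].
  destruct (Rle_dec (x n) t) as [Hle|Hgt].
  - exists (S n); split; [lia|].
    replace (S n - 1)%nat with n by lia; split; [exact Hle|apply Ht].
  - destruct n as [|n]; [exfalso; apply Hgt, Ht|].
    destruct IH as (i & Hi & Hit); [lia|unfold Icc in *; lra|].
    exists i; split; [lia|exact Hit].
Qed.

(** The difference of the two splines has zero lists, so [in_V_zero] applies on
    every knot interval. *)
Lemma spline_unique (n : nat) (x beta : nat -> R) (L L' : nat -> list R)
    (f g : R -> R) :
  (1 <= n)%nat -> increasing_knots n x -> admissible_params n beta ->
  is_spline_with_Bcoeffs n x beta L f -> is_spline_with_Bcoeffs n x beta L' g ->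
  (forall i, (1 <= i <= n)%nat -> L i = L' i) ->
  forall t, Icc (x 0%nat) (x n) t -> f t = g t.
Proof.
  intros Hn Hx Hb Hf Hg HL t Ht.
  destruct (knot_interval x n t Hn Ht) as (i & Hi & Hti).
  pose proof (spline_add _ _ _ _ _ _ _ Hf (spline_scale (-1) _ _ _ _ _ Hg))
    as [[_ HV] HB].
  enough (f t + -1 * g t = 0) by lra.
  apply (in_V_zero (beta i) (x (i - 1)%nat) (x i)
           (fun s => f s + -1 * g s)); auto.
  replace zero_list with (list_add (L i) (list_scale (-1) (L' i))); auto.
  rewrite <- (HL i Hi).
  destruct (proj2 Hf i Hi) as (df & _ & ->).
  unfold list_add, list_scale, zero_list; simpl; list_entries; ring.
Qed.

(** * Refinement at the midpoints *)

Lemma refined_knots_even (x : nat -> R) (i : nat) :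
  refined_knots x (2 * i) = x i.
Proof. unfold refined_knots; now rewrite Nat.even_even, Nat.div2_double. Qed.

Lemma refined_knots_odd (x : nat -> R) (i : nat) :
  (1 <= i)%nat -> refined_knots x (2 * i - 1) = (x (i - 1)%nat + x i) / 2.
Proof.
  intros Hi; unfold refined_knots.
  replace (2 * i - 1)%nat with (2 * (i - 1) + 1)%nat by lia.
  rewrite Nat.even_odd, Nat.add_1_r, Nat.div2_succ_double.
  now replace (i - 1 + 1)%nat with i by lia.
Qed.

Lemma div2_index_even (i : nat) : Nat.div2 (2 * i + 1) = i.
Proof. rewrite Nat.add_1_r; apply Nat.div2_succ_double. Qed.

Lemma div2_index_odd (i : nat) : (1 <= i)%nat -> Nat.div2 (2 * i - 1 + 1) = i.
Proof.
  intros Hi; replace (2 * i - 1 + 1)%nat with (2 * i)%nat by lia.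
  apply Nat.div2_double.
Qed.

(** Every fine interval is the left or the right half of a coarse one. *)
Lemma refined_index (n : nat) (P : nat -> Prop) :
  (forall i, (1 <= i <= n)%nat -> P (2 * i - 1)%nat) ->
  (forall i, (1 <= i <= n)%nat -> P (2 * i)%nat) ->
  forall j, (1 <= j <= 2 * n)%nat -> P j.
Proof.
  intros Hl Hr j Hj.
  destruct (Nat.Even_or_Odd j) as [[i ->]|[i ->]].
  - apply Hr; lia.
  - replace (2 * i + 1)%nat with (2 * (i + 1) - 1)%nat by lia; apply Hl; lia.
Qed.

Lemma refined_knot_before_odd (x : nat -> R) (i : nat) :
  (1 <= i)%nat -> refined_knots x (2 * i - 1 - 1) = x (i - 1)%nat.
Proof.
  intros Hi; replace (2 * i - 1 - 1)%nat with (2 * (i - 1))%nat by lia.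
  apply refined_knots_even.
Qed.

Lemma refined_knots_increasing (n : nat) (x : nat -> R) :
  increasing_knots n x -> increasing_knots (2 * n) (refined_knots x).
Proof.
  intros Hx; unfold increasing_knots.
  apply refined_index; intros i Hi; specialize (Hx i Hi).
  - rewrite refined_knot_before_odd, refined_knots_odd by lia; lra.
  - rewrite refined_knots_even, refined_knots_odd by lia; lra.
Qed.

Lemma refined_params_admissible (n : nat) (beta : nat -> R) :
  admissible_params n beta -> admissible_params (2 * n) (refined_params beta).
Proof.
  intros Hb; unfold admissible_params, refined_params.
  apply refined_index; intros i Hi.
  - rewrite div2_index_odd by lia; auto.
  - rewrite div2_index_even; auto.
Qed.

Definition refined_lists (beta : nat -> R) (L : nat -> list R) (j : nat)
  : list R :=
  let i := Nat.div2 (j + 1) in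
  if Nat.even j then right_half (beta i) (L i) else left_half (beta i) (L i).

Lemma refined_lists_even (beta : nat -> R) (L : nat -> list R) (i : nat) :
  refined_lists beta L (2 * i) = right_half (beta i) (L i).
Proof.
  unfold refined_lists; now rewrite div2_index_even, Nat.even_even.
Qed.

Lemma refined_lists_odd (beta : nat -> R) (L : nat -> list R) (i : nat) :
  (1 <= i)%nat ->
  refined_lists beta L (2 * i - 1) = left_half (beta i) (L i).
Proof.
  intros Hi; unfold refined_lists; rewrite div2_index_odd by lia.
  replace (2 * i - 1)%nat with (2 * (i - 1) + 1)%nat by lia.
  now rewrite Nat.even_odd.
Qed.

(** The inclusion of the coarse spline space in the refined one, with the
    effect on B-coefficients: half-intervals are dyadic, so the defining rules
    are inherited, and the rule on the whole interval yields the new lists. *)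
Lemma spline_subdivide (n : nat) (x beta : nat -> R) (L : nat -> list R)
    (g : R -> R) :
  increasing_knots n x -> admissible_params n beta ->
  is_spline_with_Bcoeffs n x beta L g ->
  is_spline_with_Bcoeffs (2 * n) (refined_knots x) (refined_params beta)
    (refined_lists beta L) g.
Proof.
  intros Hx Hb [[HC HV] HB]; split; [split|].
  - rewrite refined_knots_even; exact HC.
  - apply refined_index; intros i Hi; unfold refined_params.
    + rewrite div2_index_odd, refined_knot_before_odd, refined_knots_odd by lia.
      apply in_V_dyadic with (x (i - 1)%nat) (x i); auto.
      apply dyadic_left, dyadic_whole.
    + rewrite div2_index_even, refined_knots_even, refined_knots_odd by lia.
      apply in_V_dyadic with (x (i - 1)%nat) (x i); auto.
      apply dyadic_right, dyadic_whole.
  - apply refined_index; intros i Hi; unfold refined_params;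
      destruct (has_Bcoeffs_halves _ _ _ _ _ (Hb i Hi) (Hx i Hi) (HV i Hi)
                  (HB i Hi)) as [Hl Hr].
    + rewrite div2_index_odd, refined_knot_before_odd, refined_knots_odd,
        refined_lists_odd by lia; exact Hl.
    + rewrite div2_index_even, refined_knots_even, refined_knots_odd,
        refined_lists_even by lia; exact Hr.
Qed.

(** Splines on coarse and fine knots are compared through their lists on the
    fine intervals, here sorted into left and right halves. *)
Lemma refinement_eq (n : nat) (x beta : nat -> R) (L M : nat -> list R)
    (f g : R -> R) :
  (1 <= n)%nat -> increasing_knots n x -> admissible_params n beta ->
  is_spline_with_Bcoeffs n x beta L f ->
  is_spline_with_Bcoeffs (2 * n) (refined_knots x) (refined_params beta) M g ->
  (forall i, (1 <= i <= n)%nat ->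
     left_half (beta i) (L i) = M (2 * i - 1)%nat /\
     right_half (beta i) (L i) = M (2 * i)%nat) ->
  forall t, Icc (x 0%nat) (x n) t -> f t = g t.
Proof.
  intros Hn Hx Hb Hf Hg HL t Ht.
  apply (spline_unique (2 * n) (refined_knots x) (refined_params beta)
           (refined_lists beta L) M).
  - lia.
  - now apply refined_knots_increasing.
  - now apply refined_params_admissible.
  - now apply spline_subdivide.
  - exact Hg.
  - apply refined_index; intros i Hi; destruct (HL i Hi).
    + now rewrite refined_lists_odd by lia.
    + now rewrite refined_lists_even.
  - rewrite refined_knots_even; exact Ht.
Qed.

Lemma weighted_step_pos (n : nat) (x beta : nat -> R) (i : nat) :
  increasing_knots n x -> admissible_params n beta -> (1 <= i <= n)%nat ->
  0 < theta (beta i) * (x i - x (i - 1)%nat).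
Proof.
  intros Hx Hb Hi; specialize (Hx i Hi).
  pose proof (theta_pos _ (proj2 (Hb i Hi))).
  apply Rmult_lt_0_compat; lra.
Qed.

Lemma omega_refined_odd (n : nat) (x beta : nat -> R) (i : nat) :
  increasing_knots n x -> admissible_params n beta -> (1 <= i <= n)%nat ->
  omega (refined_knots x) (refined_params beta) (2 * i - 1) = 1 / 2.
Proof.
  intros Hx Hb Hi.
  pose proof (weighted_step_pos n x beta i Hx Hb Hi) as Hpos.
  unfold omega, refined_params; cbv zeta.
  rewrite !div2_index_odd, refined_knot_before_odd, !refined_knots_odd by lia.
  replace (2 * i - 1 + 1)%nat with (2 * i)%nat by lia.
  rewrite div2_index_even, refined_knots_even, refined_knots_odd by lia.
  field; lra.
Qed.

Lemma omega_refined_even (n : nat) (x beta : nat -> R) (i : nat) :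
  increasing_knots n x -> admissible_params n beta -> (1 <= i <= n - 1)%nat ->
  omega (refined_knots x) (refined_params beta) (2 * i) = omega x beta i.
Proof.
  intros Hx Hb Hi.
  pose proof (weighted_step_pos n x beta i Hx Hb ltac:(lia)) as Hpos.
  pose proof (weighted_step_pos n x beta (i + 1) Hx Hb ltac:(lia)) as Hpos'.
  unfold omega, refined_params; cbv zeta.
  replace (2 * i + 1)%nat with (2 * (i + 1) - 1)%nat by lia.
  rewrite div2_index_odd, refined_knot_before_odd, !refined_knots_odd by lia.
  replace (2 * (i + 1) - 1)%nat with (2 * i + 1)%nat by lia.
  rewrite div2_index_even, refined_knots_even.
  replace (i + 1 - 1)%nat with i in * by lia.
  field; lra.
Qed.

(** * The refinement equations *)

(* The subscript tests decide which supports meet the interval at hand; what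
   remains are polynomial identities in [beta i] and [omega x beta i]. *)
Ltac compare_lists :=
  unfold list_on, lists_on_succ;
  repeat match goal with
  | |- context [Nat.eqb ?p ?q] => destruct (Nat.eqb_spec p q); try lia
  end; subst;
  unfold list_add, list_scale, zero_list, left_half, right_half; simpl;
  list_entries; field.

Theorem theorem6 (n : nat) (a b : R) (x beta : nat -> R)
    (B Bbar : nat -> R -> R)
    (hn : (1 <= n)%nat)
    (hx : is_partition n a b x)
    (hbeta : forall i, (1 <= i <= n)%nat -> -1 <= beta i < 0)
    (hB : is_Bsplines n x beta B)
    (hBbar : is_Bsplines (2 * n) (refined_knots x) (refined_params beta) Bbar) :
  (forall i, (1 <= i <= n - 1)%nat ->
    (forall t, Icc a b t ->
      B (2 * i)%nat t =
        (1 / 2 + 1 / 4 * beta i) * Bbar (4 * i - 2)%nat t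
        + (1 / 2 - 1 / 4 * beta i) * Bbar (4 * i - 1)%nat t
        + 1 / 2 * (1 + omega x beta i) * Bbar (4 * i)%nat t
        + 1 / 2 * omega x beta i * Bbar (4 * i + 1)%nat t) /\
    (forall t, Icc a b t ->
      B (2 * i + 1)%nat t =
        1 / 2 * (1 - omega x beta i) * Bbar (4 * i)%nat t
        + 1 / 2 * (2 - omega x beta i) * Bbar (4 * i + 1)%nat t
        + (1 / 2 - 1 / 4 * beta (i + 1)%nat) * Bbar (4 * i + 2)%nat t
        + (1 / 2 + 1 / 4 * beta (i + 1)%nat) * Bbar (4 * i + 3)%nat t)) /\
  ((forall t, Icc a b t ->
      B 0%nat t = Bbar 0%nat t + 1 / 2 * Bbar 1%nat t) /\
   (forall t, Icc a b t ->
      B 1%nat t =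
        1 / 2 * Bbar 1%nat t
        + (1 / 2 - 1 / 4 * beta 1%nat) * Bbar 2%nat t
        + (1 / 2 + 1 / 4 * beta 1%nat) * Bbar 3%nat t) /\
   (forall t, Icc a b t ->
      B (2 * n)%nat t =
        1 / 2 * Bbar (4 * n)%nat t
        + (1 / 2 - 1 / 4 * beta n) * Bbar (4 * n - 1)%nat t
        + (1 / 2 + 1 / 4 * beta n) * Bbar (4 * n - 2)%nat t) /\
   (forall t, Icc a b t ->
      B (2 * n + 1)%nat t =
        1 / 2 * Bbar (4 * n)%nat t + Bbar (4 * n + 1)%nat t)).
Proof.
  destruct hx as (<- & <- & Hx).
  fold (increasing_knots n x) in Hx.
  fold (admissible_params n beta) in hbeta.
  destruct hB as [Beven Bodd Bfirst0 Bfirst1 Blast0 Blast1].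
  destruct hBbar as [Feven Fodd Ffirst0 Ffirst1 Flast0 Flast1].
  (* The fine B-splines come in pairs: [Bbar (4 * i - 2)], [Bbar (4 * i - 1)] at
     the midpoint of the i-th coarse interval, [Bbar (4 * i)],
     [Bbar (4 * i + 1)] at the coarse knot [x i]. *)
  assert (Fmid0 : forall i, (1 <= i <= n)%nat ->
    is_spline_with_Bcoeffs (2 * n) (refined_knots x) (refined_params beta)
      (lists_on_succ (2 * i - 1) [0; 0; 1; 1 / 2] [1 / 2; 0; 0; 0])
      (Bbar (4 * i - 2)%nat)).
  { intros i Hi.
    replace (4 * i - 2)%nat with (2 * (2 * i - 1))%nat by lia.
    rewrite <- (omega_refined_odd n x beta i) by auto; apply Feven; lia. }
  assert (Fmid1 : forall i, (1 <= i <= n)%nat ->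
    is_spline_with_Bcoeffs (2 * n) (refined_knots x) (refined_params beta)
      (lists_on_succ (2 * i - 1) [0; 0; 0; 1 - 1 / 2] [1 - 1 / 2; 1; 0; 0])
      (Bbar (4 * i - 1)%nat)).
  { intros i Hi.
    replace (4 * i - 1)%nat with (2 * (2 * i - 1) + 1)%nat by lia.
    rewrite <- (omega_refined_odd n x beta i) by auto; apply Fodd; lia. }
  assert (Fold0 : forall i, (1 <= i <= n - 1)%nat ->
    is_spline_with_Bcoeffs (2 * n) (refined_knots x) (refined_params beta)
      (lists_on_succ (2 * i) [0; 0; 1; omega x beta i] [omega x beta i; 0; 0; 0])
      (Bbar (4 * i)%nat)).
  { intros i Hi.
    replace (4 * i)%nat with (2 * (2 * i))%nat by lia.
    rewrite <- (omega_refined_even n x beta i) by auto; apply Feven; lia. }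
  assert (Fold1 : forall i, (1 <= i <= n - 1)%nat ->
    is_spline_with_Bcoeffs (2 * n) (refined_knots x) (refined_params beta)
      (lists_on_succ (2 * i) [0; 0; 0; 1 - omega x beta i]
                             [1 - omega x beta i; 1; 0; 0])
      (Bbar (4 * i + 1)%nat)).
  { intros i Hi.
    replace (4 * i + 1)%nat with (2 * (2 * i) + 1)%nat by lia.
    rewrite <- (omega_refined_even n x beta i) by auto; apply Fodd; lia. }
  replace (2 * (2 * n))%nat with (4 * n)%nat in Flast0, Flast1 by lia.
  clear Feven Fodd.
  split; [intros i Hi; split|repeat split].
  - eapply refinement_eq; [exact hn|exact Hx|exact hbeta|apply Beven, Hi| |].
    + repeat apply spline_add; apply spline_scale;
        [apply Fmid0; lia|apply Fmid1; lia|apply Fold0, Hi|apply Fold1, Hi].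
    + intros r Hr; split; compare_lists.
  - pose proof (Fmid0 (i + 1)%nat ltac:(lia)) as G0.
    pose proof (Fmid1 (i + 1)%nat ltac:(lia)) as G1.
    replace (4 * (i + 1) - 2)%nat with (4 * i + 2)%nat in G0 by lia.
    replace (4 * (i + 1) - 1)%nat with (4 * i + 3)%nat in G1 by lia.
    eapply refinement_eq; [exact hn|exact Hx|exact hbeta|apply Bodd, Hi| |].
    + repeat apply spline_add; apply spline_scale;
        [apply Fold0, Hi|apply Fold1, Hi|exact G0|exact G1].
    + intros r Hr; split; compare_lists.
  - eapply refinement_eq; [exact hn|exact Hx|exact hbeta|exact Bfirst0| |].
    + apply spline_add; [exact Ffirst0|apply spline_scale, Ffirst1].
    + intros r Hr; split; compare_lists.
  - eapply refinement_eq; [exact hn|exact Hx|exact hbeta|exact Bfirst1| |].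
    + repeat apply spline_add; apply spline_scale;
        [exact Ffirst1|exact (Fmid0 1%nat ltac:(lia))
        |exact (Fmid1 1%nat ltac:(lia))].
    + intros r Hr; split; compare_lists.
  - eapply refinement_eq; [exact hn|exact Hx|exact hbeta|exact Blast0| |].
    + repeat apply spline_add; apply spline_scale;
        [exact Flast0|apply Fmid1; lia|apply Fmid0; lia].
    + intros r Hr; split; compare_lists.
  - eapply refinement_eq; [exact hn|exact Hx|exact hbeta|exact Blast1| |].
    + apply spline_add; [apply spline_scale, Flast0|exact Flast1].
    + intros r Hr; split; compare_lists.
Qed.
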